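(* Let $\mathcal{H}=\{\mathcal{M}_{Y_1},\ldots,\mathcal{M}_{Y_m}\}$ be an associative family of matroids whose graph $\mathcal{G}_{\mathcal{H}}$ is connected and has non-empty edge set. Let $\mathcal{H}$ be partitioned as $\mathcal{H}_1\uplus\cdots\uplus\mathcal{H}_n$. Then $\mathcal{H}$ is rigid iff $\mathcal{H}_1,\ldots,\mathcal{H}_n$ and $\{\leftrightarrow(\mathcal{H}_1),\ldots,\leftrightarrow(\mathcal{H}_n)\}$ are rigid.
   Context: All matroids are on finite sets; $r$ is rank, $\mathcal{M}^*$ the dual, $\mathcal{M}\circ T$ restriction to $T$, $\mathcal{M}\times T=(\mathcal{M}^*\circ T)^*$ contraction to $T$. The union $\mathcal{M}_{Y_1}\vee\cdots\vee\mathcal{M}_{Y_m}$ of matroids on (not necessarily equal) sets $Y_i$ is the matroid on $\bigcup_iY_i$ whose independent sets are the unions $I_1\cup\cdots\cup I_m$ with $I_i$ independent in $\mathcal{M}_{Y_i}$. An associative family is a finite family $\{\mathcal{M}_{Y_1},\ldots,\mathcal{M}_{Y_m}\}$ of matroids, $\mathcal{M}_{Y_i}$ on $Y_i$, such that no element of $\bigcup_iY_i$ belongs to more than two of the $Y_i$. Let $Z$ be the set of elements belonging to exactly one of the $Y_i$; define $\leftrightarrow(\mathcal{H})=(\mathcal{M}_{Y_1}\vee\cdots\vee\mathcal{M}_{Y_m})\times Z$ (if $Z=\emptyset$ this is the matroid $\mathcal{M}_\emptyset$ on the empty set). The graph $\mathcal{G}_{\mathcal{H}}$ has the members $\mathcal{M}_{Y_i}$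 as vertices and the elements of $\bigcup_iY_i$ as edges: $e$ joins $\mathcal{M}_{Y_i}$ and $\mathcal{M}_{Y_j}$ ($i\neq j$) if $e\in Y_i\cap Y_j$, and $e$ is a self-loop at $\mathcal{M}_{Y_i}$ if $Y_i$ is the only set containing $e$. An associative family $\{\mathcal{M}_{Y_1},\ldots,\mathcal{M}_{Y_m}\}$ is rigid iff $r(\bigvee_i\mathcal{M}_{Y_i})=\sum_ir(\mathcal{M}_{Y_i})$ and $r(\bigvee_i\mathcal{M}_{Y_i}^* )=\sum_ir(\mathcal{M}_{Y_i}^* )$. A subfamily of an associative family is again an associative family, with $\leftrightarrow$ computed within the subfamily. The blocks of a partition are nonempty. *)

(* Defs.v *)
From mathcomp Require Import all_boot.

Set Implicit Arguments.
Unset Strict Implicit.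
Unset Printing Implicit Defensive.

(** The ground sets of all the matroids of a family are subsets of one ambient
    finite type [E], so that they may overlap. *)
Record matroid (E : finType) := Matroid {
  ground : {set E};
  indep : {set {set E}};
  indep_ground : forall A : {set E}, A \in indep -> A \subset ground;
  indep0 : set0 \in indep;
  indep_sub : forall A B : {set E}, A \subset B -> B \in indep -> A \in indep;
  indep_augment : forall A B : {set E}, A \in indep -> B \in indep -> #|A| < #|B| ->
    exists2 x, x \in B :\: A & x |: A \in indep }.

Section Operations.
Variable E : finType.
Implicit Types (M : matroid E) (A B S T : {set E}).

Definition rank M : nat := \max_(A in indep M) #|A|.

Definition basis M B : bool := maxset (mem (indep M)) B.

Lemma indep_extend M A B : A \in indep M -> B \in indep M -> #|A| <= #|B| ->
  exists C, [/\ C \in indep M, A \subset C, C \subset A :|: B & #|C| = #|B|].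
Proof.
move=> IA IB; move: {2}(#|B| - #|A|) (leqnn (#|B| - #|A|)) => k.
elim: k A IA => [|k IH] A IA Hk leAB.
  by exists A; split=> //; [apply: subsetUl | apply/eqP; rewrite eqn_leq leAB -subn_eq0 -leqn0].
have [ltAB|] := ltnP #|A| #|B|; last first.
  move=> leBA; exists A; split=> //; first exact: subsetUl.
  by apply/eqP; rewrite eqn_leq leAB.
have [x /setDP[xB xA] IxA] := indep_augment IA IB ltAB.
have cxA : #|x |: A| = #|A|.+1 by rewrite cardsU1 xA.
have [||C [IC sC CsU cC]] := IH _ IxA; rewrite ?cxA //.
  by rewrite subnS -subn1 leq_subLR add1n.
exists C; split=> //; first exact: subset_trans (subsetUr _ _) sC.
apply: subset_trans CsU _; rewrite !subUset sub1set inE xB orbT /=.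
by rewrite subsetUl subsetUr.
Qed.

Lemma basis_card M B : basis M B -> forall A, A \in indep M -> #|A| <= #|B|.
Proof.
case/maxsetP=> /= IB maxB A IA; rewrite leqNgt; apply/negP => ltBA.
have [x /setDP[_ /negP xB] IxB] := indep_augment IB IA ltBA.
by apply: xB; rewrite -(maxB _ IxB (subsetUr _ _)) setU11.
Qed.

Lemma card_basis M B : B \in indep M ->
  (forall A, A \in indep M -> #|A| <= #|B|) -> basis M B.
Proof.
move=> IB maxB; apply/maxsetP; split=> // A IA sBA.
by apply/esym/eqP; rewrite eqEcard sBA maxB.
Qed.

Lemma basis_exists M : exists B, basis M B.
Proof.
by have [B maxB _] := maxset_exists (indep0 M : (mem (indep M)) set0); exists B.
Qed.

Definition dual_indep M : {set {set E}} :=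
  [set S : {set E} | [exists B, basis M B && (S \subset ground M :\: B)]].

Lemma dual_indepP M S :
  reflect (exists2 B, basis M B & S \subset ground M :\: B)
          (S \in dual_indep M).
Proof. by rewrite inE; apply: exists_inP. Qed.

Lemma dual_indep_ground M S : S \in dual_indep M -> S \subset ground M.
Proof. by case/dual_indepP=> B _ /subset_trans; apply; apply: subsetDl. Qed.

Lemma dual_indep0 M : set0 \in dual_indep M.
Proof.
by have [B bB] := basis_exists M; apply/dual_indepP; exists B; rewrite ?sub0set.
Qed.

Lemma dual_indep_sub M S T :
  S \subset T -> T \in dual_indep M -> S \in dual_indep M.
Proof.
move=> sST /dual_indepP[B bB sTB]; apply/dual_indepP; exists B => //.
exact: subset_trans sST sTB.
Qed.

Lemma dual_indep_augment M S T :
  S \in dual_indep M -> T \in dual_indep M -> #|S| < #|T| ->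
  exists2 x, x \in T :\: S & x |: S \in dual_indep M.
Proof.
case/dual_indepP=> B1 b1; rewrite subsetD => /andP[SG dS1].
case/dual_indepP=> B2 b2; rewrite subsetD => /andP[TG dT2] ltST.
have [/= I1 _] := maxsetP b1; have [/= I2 _] := maxsetP b2.
have I3 : B2 :\: S \in indep M by apply: indep_sub I2; apply: subsetDl.
have [B [IB sB BsU cB]] := indep_extend I3 I1 (basis_card b1 I3).
have bB : basis M B.
  by apply: (card_basis IB) => A IA; rewrite cB (basis_card b1 IA).
have dSB : [disjoint S & B].
  apply/pred0P=> x /=; apply/negP=> /andP[xS /(subsetP BsU)].
  by rewrite !inE xS /=; apply/negP; rewrite (disjointFr dS1 xS).
have [x /andP[xTS xB]] : exists x, (x \in T :\: S) && (x \notin B).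
  apply/existsP; rewrite -[[exists _, _]]negbK negb_exists; apply/negP.
  move=> /forallP TSB.
  have {}TSB : T :\: S \subset B.
    by apply/subsetP=> x xT; move: (TSB x); rewrite xT negbK.
  have: #|(T :\: S) :|: (B2 :\: S)| <= #|B2|.
    apply: leq_trans (basis_card b2 IB); apply: subset_leq_card.
    by rewrite subUset TSB.
  have -> : #|(T :\: S) :|: (B2 :\: S)| = #|T :\: S| + #|B2 :\: S|.
    apply/eqP; rewrite (leq_card_setU _ _).
    by apply: disjointWl (subsetDl _ _) (disjointWr (subsetDl _ _) dT2).
  rewrite leqNgt => /negP; apply.
  rewrite -(cardsID S B2) ltn_add2r.
  apply: (@leq_ltn_trans #|S :\: T|).
    apply: subset_leq_card; apply/subsetP=> y /setIP[yB2 yS].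
    rewrite inE yS andbT; apply/negP => yT.
    by move/disjoint_setI0: dT2 => /setP/(_ y); rewrite !inE yT yB2.
  by rewrite -(ltn_add2l #|S :&: T|) cardsID setIC cardsID.
exists x => //; apply/dual_indepP; exists B => //.
case/setDP: xTS => xT _.
rewrite subsetD subUset sub1set (subsetP TG) // SG /=.
by rewrite -setI_eq0 setIUl setU_eq0 !setI_eq0 dSB andbT disjoints1.
Qed.

Definition dual M : matroid E :=
  Matroid (@dual_indep_ground M) (dual_indep0 M) (@dual_indep_sub M)
          (@dual_indep_augment M).

Definition restr_indep M T : {set {set E}} := [set A in indep M | A \subset T].

Lemma restr_indep_ground M T A :
  A \in restr_indep M T -> A \subset ground M :&: T.
Proof. by rewrite inE subsetI => /andP[/indep_ground-> ->]. Qed.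

Lemma restr_indep0 M T : set0 \in restr_indep M T.
Proof. by rewrite inE indep0 sub0set. Qed.

Lemma restr_indep_sub M T A B :
  A \subset B -> B \in restr_indep M T -> A \in restr_indep M T.
Proof.
move=> sAB; rewrite !inE => /andP[/(indep_sub sAB)-> sBT].
exact: subset_trans sBT.
Qed.

Lemma restr_indep_augment M T A B :
  A \in restr_indep M T -> B \in restr_indep M T -> #|A| < #|B| ->
  exists2 x, x \in B :\: A & x |: A \in restr_indep M T.
Proof.
rewrite !inE => /andP[IA sAT] /andP[IB sBT] ltAB.
have [x xBA IxA] := indep_augment IA IB ltAB; exists x => //.
case/setDP: xBA => xB _.
by rewrite inE IxA subUset sub1set (subsetP sBT).
Qed.

(** Restriction to [T]; it is only meant for [T \subset ground M], and
    restricts to [ground M :&: T] otherwise. *)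
Definition restriction M T : matroid E :=
  Matroid (@restr_indep_ground M T) (restr_indep0 M T) (@restr_indep_sub M T)
          (@restr_indep_augment M T).

(** Contraction *to* [T], i.e. of the elements outside [T]. *)
Definition contraction M T : matroid E := dual (restriction (dual M) T).

End Operations.

Section Families.
Variables (E I : finType) (M : I -> matroid E).
Implicit Types (A B S : {set E}).

Definition union_ground : {set E} := \bigcup_i ground (M i).

Definition union_indep : {set {set E}} :=
  [set S | [exists F : {ffun I -> {set E}},
     [forall i, F i \in indep (M i)] && (S == \bigcup_i F i)]].

Lemma union_indepP S :
  reflect (exists2 F : {ffun I -> {set E}},
             forall i, F i \in indep (M i) & S = \bigcup_i F i)
          (S \in union_indep).
Proof.
rewrite inE; apply: (iffP existsP) => [[F /andP[/forallP IF /eqP dS]]|[F IF dS]].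
  by exists F.
by exists F; rewrite dS eqxx andbT; apply/forallP.
Qed.

Lemma union_indep_ground S : S \in union_indep -> S \subset union_ground.
Proof.
case/union_indepP=> F IF ->; apply/bigcupsP=> i _.
by apply: subset_trans (bigcup_sup i _); rewrite ?indep_ground.
Qed.

Lemma union_indep0 : set0 \in union_indep.
Proof.
apply/union_indepP; exists [ffun _ => set0] => [i|].
  by rewrite ffunE indep0.
by rewrite big1 // => i _; rewrite ffunE.
Qed.

Lemma union_indep_sub A B :
  A \subset B -> B \in union_indep -> A \in union_indep.
Proof.
move=> sAB /union_indepP[F IF dB]; apply/union_indepP.
exists [ffun i => A :&: F i] => [i|].
  by rewrite ffunE; apply: indep_sub (IF i); apply: subsetIr.
under eq_bigr do rewrite ffunE.
by rewrite -big_distrr /= -dB; apply/esym/setIidPl.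
Qed.

(* A colouring records a decomposition of [S] into pairwise disjoint sets. *)
Definition coloring S (c : {ffun E -> option I}) : bool :=
  [forall x in S, c x != None] &&
  [forall i, [set x in S | c x == Some i] \in indep (M i)].

Lemma coloringP S :
  reflect (exists c, coloring S c) (S \in union_indep).
Proof.
apply: (iffP (union_indepP S)) => [[F IF dS]|[c /andP[/forall_inP cS /forallP Ic]]].
  exists [ffun x => [pick i | x \in F i]]; apply/andP; split.
    apply/forall_inP=> x; rewrite dS => /bigcupP[i _ xFi]; rewrite ffunE.
    by case: pickP => // /(_ i); rewrite xFi.
  apply/forallP=> i; apply: indep_sub (IF i); apply/subsetP=> x.
  rewrite inE ffunE => /andP[_]; case: pickP => // j xFj /eqP[<-].
  exact: xFj.
exists [ffun i => [set x in S | c x == Some i]] => [i|]; first by rewrite ffunE.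
apply/setP=> x; apply/idP/bigcupP => [xS|[i _]]; last first.
  by rewrite ffunE inE => /andP[].
case cx: (c x) => [i|]; last by move: (cS x xS); rewrite cx.
by exists i; rewrite // ffunE inE xS cx eqxx.
Qed.

Lemma coloring_card S c : coloring S c ->
  #|S| = \sum_i #|[set x in S | c x == Some i]|.
Proof.
case/andP=> /forall_inP cS _; rewrite -sum1_card.
under [RHS]eq_bigr => i _.
  rewrite -sum1_card.
  under eq_bigl do rewrite inE.
  rewrite big_mkcondr.
  over.
rewrite exchange_big /=; apply: eq_bigr => x xS.
case cx: (c x) => [i|]; last by move: (cS x xS); rewrite cx.
rewrite (bigD1 i) //= eqxx big1 ?addn0 // => j nij.
by case: eqP => // -[eij]; rewrite eij eqxx in nij.
Qed.

Lemma union_indep_augment A B :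
  A \in union_indep -> B \in union_indep -> #|A| < #|B| ->
  exists2 x, x \in B :\: A & x |: A \in union_indep.
Proof.
move=> /coloringP[c0 col0] /coloringP[d cold] ltAB.
pose agree (c : {ffun E -> option I}) := #|[set x in A :&: B | c x == d x]|.
case: (@arg_maxnP _ c0 (coloring A) agree col0) => c colc maxc.
have [i lti] : exists i, #|[set x in A | c x == Some i]|
                          < #|[set x in B | d x == Some i]|.
  apply/existsP; rewrite -[[exists _, _]]negbK negb_exists; apply/negP.
  move=> /forallP le; move: ltAB.
  rewrite (coloring_card colc) (coloring_card cold) ltnNge => /negP; apply.
  by apply: leq_sum => i _; rewrite leqNgt le.
have [/forall_inP cA /forallP Ic] := andP colc.
have [_ /forallP Id] := andP cold.
have [y /setDP[]] := indep_augment (Ic i) (Id i) lti.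
rewrite !inE => /andP[yB /eqP dy] ny IyA.
pose c' := [ffun x => if x == y then Some i else c x].
have colc' : coloring (y |: A) c'.
  apply/andP; split.
    apply/forall_inP=> x; rewrite !inE ffunE; case: eqP => //= _.
    exact: cA.
  apply/forallP=> j; have [->|nij] := eqVneq j i.
    apply: indep_sub IyA; apply/subsetP=> x; rewrite !inE ffunE.
    by case: (x == y).
  apply: indep_sub (Ic j); apply/subsetP=> x; rewrite !inE ffunE.
  case: (x == y) => //= /eqP[eij]; by rewrite eij eqxx in nij.
have [yA|yA] := boolP (y \in A); last first.
  exists y; first by rewrite inE yA.
  by apply/coloringP; exists c'.
have eA : y |: A = A by apply/setUidPr; rewrite sub1set.
rewrite eA in colc'; move: (maxc _ colc'); rewrite /= leqNgt => /negP[].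
apply: proper_card; apply/properP; split.
  apply/subsetP=> x; rewrite !inE ffunE => /andP[-> cdx] /=.
  by case: (x =P y) => [->|//]; rewrite dy.
exists y; rewrite !inE yA yB ?ffunE ?eqxx ?dy //=.
by move: ny; rewrite yA.
Qed.

Definition munion : matroid E :=
  Matroid union_indep_ground union_indep0 union_indep_sub union_indep_augment.

Definition members (e : E) : {set I} := [set i | e \in ground (M i)].

Definition associative_family : Prop := forall e, #|members e| <= 2.

(** When no element lies in exactly one ground set, [arrow] is the unique
    matroid with empty ground set. *)
Definition outer_elements : {set E} := [set e | #|members e| == 1].

Definition arrow : matroid E := contraction munion outer_elements.

(** The (multi)graph of a family: vertices [I], edges [graph_edges], with
    [joins e i j] when [e] has endpoints [i] and [j]. *)
Definition graph_edges : {set E} := union_ground.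

Definition joins (e : E) (i j : I) : bool :=
  if i == j then members e == [set i]
  else (e \in ground (M i)) && (e \in ground (M j)).

Definition graph_adj : rel I :=
  [rel i j | [exists e in graph_edges, joins e i j]].

Definition graph_connected : Prop := forall i j, connect graph_adj i j.

End Families.

Definition rigid (E I : finType) (M : I -> matroid E) : Prop :=
  rank (munion M) = \sum_i rank (M i) /\
  rank (munion (fun i => dual (M i))) = \sum_i rank (dual (M i)).

Definition subfamily (E I : finType) (M : I -> matroid E) (A : {set I}) :
    {i | i \in A} -> matroid E :=
  fun i => M (val i).
Arguments subfamily {E I} M A i.

Definition arrow_family (E I : finType) (M : I -> matroid E)
    (P : {set {set I}}) : {A | A \in P} -> matroid E :=
  fun A => arrow (subfamily M (val A)).
Arguments arrow_family {E I} M P A.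

(* [rigid] is only meant for associative families; subfamilies and arrow
   families of an associative family are again associative. *)
Lemma subfamily_associative (E I : finType) (M : I -> matroid E) (A : {set I}) :
  associative_family M -> associative_family (subfamily M A).
Proof.
move=> assM e; apply: leq_trans (assM e).
rewrite -(card_imset _ val_inj); apply: subset_leq_card.
by apply/subsetP=> _ /imsetP[i ie ->]; move: ie; rewrite !inE.
Qed.

Lemma ground_arrow (E I : finType) (M : I -> matroid E) :
  ground (arrow M) = outer_elements M.
Proof.
apply/setIidPr; apply/subsetP=> e; rewrite inE => /cards1P[i ei].
apply/bigcupP; exists i => //.
by move/setP/(_ i): ei; rewrite !inE eqxx.
Qed.

Lemma arrow_family_associative (E I : finType) (M : I -> matroid E)
    (P : {set {set I}}) :
  partition P [set: I] -> associative_family M ->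
  associative_family (arrow_family M P).
Proof.
case/and3P=> _ tiP _ assM e; apply: leq_trans (assM e).
rewrite -(card_imset _ val_inj).
apply: leq_trans (leq_imset_card (pblock P) _).
apply: subset_leq_card; apply/subsetP=> _ /imsetP[A Ae ->].
move: Ae; rewrite inE ground_arrow inE => /cards1P[i /setP/(_ i)].
rewrite !inE eqxx => ei; apply/imsetP; exists (val i); first by rewrite inE.
by rewrite (def_pblock tiP (valP A) (valP i)).
Qed.

(* Main.v *)
Require Import Defs.
From mathcomp Require Import all_boot.

Set Implicit Arguments.
Unset Strict Implicit.
Unset Printing Implicit Defensive.

(** The key is a symmetric description of rigidity.  Call bases [B i] of the
    [M i] complementary if an element common to two ground sets lies in exactly
    one of the two corresponding bases.  An associative family is rigid iff it
    has complementary bases ([rigid_complementary], [complementary_rigid]).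

    Complementary bases are pairwise disjoint, so their union has the size
    required for the rank of the union; and the complements of complementary
    bases are complementary bases of the dual matroids.  Conversely, if both
    rank conditions hold, pairwise disjoint bases of the duals show that the
    set [X] of shared elements is covered by bases, hence independent in the
    union matroid; any basis of the union that contains [X] then splits into
    pairwise disjoint bases which still cover [X], that is, into complementary
    bases.

    When a family is rigid, [X] is independent in its union, so contracting it
    is transparent: the bases of the arrow matroid are the traces, on the outer
    elements, of the unions of complementary bases
    ([complementary_basis_arrow], [basis_arrow_complementary]).  The theorem
    follows by splitting the condition of being complementary along the
    partition: for an element shared inside a block it is a condition on that
    block, and for an element shared between two blocks, which is outer in
    both, it is a condition on the traces, i.e. on the arrow family.  *)

(** * Bases, duality and contraction *)

Section Bases.
Variable E : finType.
Implicit Types (M : matroid E) (A B S T J : {set E}).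

Lemma basis_indep M B : basis M B -> B \in indep M.
Proof. by case/maxsetP. Qed.

Lemma basis_ground M B : basis M B -> B \subset ground M.
Proof. by move/basis_indep/indep_ground. Qed.

Lemma indep_card_rank M A : A \in indep M -> #|A| <= rank M.
Proof. by move=> IA; rewrite /rank (bigmax_sup A). Qed.

Lemma basis_rank M B : basis M B -> #|B| = rank M.
Proof.
move=> bB; apply/eqP; rewrite eqn_leq indep_card_rank ?basis_indep //.
by apply/bigmax_leqP=> A; apply: basis_card.
Qed.

Lemma indep_rank_basis M B : B \in indep M -> rank M <= #|B| -> basis M B.
Proof.
move=> IB leB; apply: card_basis => // A IA.
exact: leq_trans (indep_card_rank IA) leB.
Qed.

Lemma indep_sub_basis M A : A \in indep M -> exists2 B, basis M B & A \subset B.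
Proof. by move=> IA; have [B bB sAB] := @maxset_exists _ (mem (indep M)) _ IA; exists B. Qed.

Lemma cobasis_card M B : basis M B -> #|ground M :\: B| = #|ground M| - rank M.
Proof.
by move=> bB; rewrite cardsD (setIidPr (basis_ground bB)) (basis_rank bB).
Qed.

Lemma dual_basis M B : basis M B -> basis (dual M) (ground M :\: B).
Proof.
move=> bB; apply: card_basis => [|S /dual_indepP[C bC sSC]].
  by apply/dual_indepP; exists B.
by rewrite (cobasis_card bB) -(cobasis_card bC) subset_leq_card.
Qed.

Lemma basis_dualE M S :
  basis (dual M) S = (S \subset ground M) && basis M (ground M :\: S).
Proof.
apply/idP/andP=> [bS|[sS /dual_basis]]; last first.
  by rewrite setDDr setDv set0U (setIidPr sS).
split; first exact: basis_ground bS.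
have /dual_indepP[B bB sSB] := basis_indep bS.
have -> : S = ground M :\: B.
  apply/eqP; rewrite eqEcard sSB (basis_card bS) //.
  exact: basis_indep (dual_basis bB).
by rewrite setDDr setDv set0U (setIidPr (basis_ground bB)).
Qed.

(** A basis inside [T] forces the restriction to [T] to have full rank. *)
Lemma basis_restrictionE M B T S : basis M B -> B \subset T ->
  basis (restriction M T) S = (S \subset T) && basis M S.
Proof.
move=> bB sBT.
have IB : B \in indep (restriction M T) by rewrite inE basis_indep.
apply/idP/andP=> [bS|[sST bS]].
  have := basis_indep bS; rewrite inE => /andP[IS sST]; split=> //.
  by apply: indep_rank_basis IS _; rewrite -(basis_rank bB) (basis_card bS).
apply: card_basis => [|A]; first by rewrite inE basis_indep.
by rewrite inE => /andP[IA _]; apply: basis_card bS _ IA.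
Qed.

(** When the contracted set [ground M :\: T] is independent it lies in a basis,
    whose cobasis lies in [T]; so restricting the dual to [T] keeps the rank and
    the bases of the contraction are those of [M] through the contracted set. *)
Lemma basis_contractionE M T J :
  T \subset ground M -> ground M :\: T \in indep M ->
  basis (contraction M T) J =
    (J \subset T) && basis M (J :|: (ground M :\: T)).
Proof.
move=> sT /indep_sub_basis[B bB sXB].
have sBT : ground M :\: B \subset T.
  by rewrite subDset setUC -subDset.
rewrite basis_dualE /= (setIidPr sT); apply: andb_id2l => sJ.
rewrite (basis_restrictionE _ (dual_basis bB) sBT) basis_dualE subsetDl.
rewrite (subset_trans (subsetDl _ _) sT) setDDr setUC.
by rewrite (setIidPr (subset_trans sJ sT)).
Qed.

End Bases.

(** * Unions of full rank *)

Section Unions.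
Variables (E I : finType) (M : I -> matroid E).
Implicit Types (S : {set E}) (B : I -> {set E}).

Lemma rank_munion_le : rank (munion M) <= \sum_i rank (M i).
Proof.
apply/bigmax_leqP=> S /coloringP[c colc]; rewrite (coloring_card colc).
apply: leq_sum => i _; apply: indep_card_rank.
by case/andP: colc => _ /forallP.
Qed.

Lemma disjoint_bases_munion B :
  (forall i, basis (M i) (B i)) ->
  (forall i j, i != j -> [disjoint B i & B j]) ->
  rank (munion M) = \sum_i rank (M i) /\ basis (munion M) (\bigcup_i B i).
Proof.
move=> bB dB.
have IU : \bigcup_i B i \in indep (munion M).
  apply/union_indepP; exists [ffun i => B i] => [i|].
    by rewrite ffunE basis_indep.
  by apply: eq_bigr => i _; rewrite ffunE.
have cU : #|\bigcup_i B i| = \sum_i rank (M i).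
  rewrite -sum1_card partition_disjoint_bigcup //=.
  by apply: eq_bigr => i _; rewrite sum1_card (basis_rank (bB i)).
split; last by apply: indep_rank_basis IU _; rewrite cU rank_munion_le.
by apply/eqP; rewrite eqn_leq rank_munion_le -cU indep_card_rank.
Qed.

(** The colour classes of a basis have at most the ranks of the [M i] as sizes,
    and these sizes add up to the sum of the ranks. *)
Lemma basis_munion_split S :
  rank (munion M) = \sum_i rank (M i) -> basis (munion M) S ->
  exists B : I -> {set E},
    [/\ forall i, basis (M i) (B i),
        forall i j, i != j -> [disjoint B i & B j] &
        S = \bigcup_i B i].
Proof.
move=> rM bS; have /coloringP[c colc] := basis_indep bS.
have [/forall_inP cS /forallP Ic] := andP colc.
exists (fun i => [set x in S | c x == Some i]); split.
- move=> i; apply: (indep_rank_basis (Ic i)).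
  have le j : true -> #|[set x in S | c x == Some j]| <= rank (M j) ?= iff
                (#|[set x in S | c x == Some j]| == rank (M j)).
    by move=> _; split=> //; apply: indep_card_rank.
  have [_] := leqif_sum le.
  rewrite -(coloring_card colc) (basis_rank bS) rM eqxx.
  by move/esym/forall_inP/(_ i isT)/eqP=> ->.
- move=> i j nij; rewrite -setI_eq0; apply/eqP/setP=> x; rewrite !inE.
  case: (x \in S) => //=; apply/negP=> /andP[/eqP-> /eqP[eij]].
  by rewrite eij eqxx in nij.
- apply/setP=> x; apply/idP/bigcupP=> [xS|[i _]]; last by rewrite inE => /andP[].
  case cx: (c x) (cS x xS) => [i|] // _.
  by exists i; rewrite // inE xS cx eqxx.
Qed.

End Unions.

(** * Complementary bases *)

Definition complementary (E I : finType) (M : I -> matroid E)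
    (B : I -> {set E}) : Prop :=
  (forall i, basis (M i) (B i)) /\
  (forall i j e, i != j -> e \in ground (M i) -> e \in ground (M j) ->
     (e \in B i) = (e \notin B j)).

Lemma complementary_disjoint (E I : finType) (M : I -> matroid E)
    (B : I -> {set E}) :
  complementary M B -> forall i j, i != j -> [disjoint B i & B j].
Proof.
case=> bB cB i j nij; rewrite -setI_eq0; apply/eqP/setP=> e; rewrite !inE.
apply/negP=> /andP[ei ej].
have gi := subsetP (basis_ground (bB i)) e ei.
have gj := subsetP (basis_ground (bB j)) e ej.
by move: ei; rewrite (cB i j e nij gi gj) ej.
Qed.

Section Complementary.
Variables (E I : finType) (M : I -> matroid E).
Implicit Types (S J : {set E}) (B : I -> {set E}).

Lemma complementary_dual B : complementary M B ->
  complementary (fun i => dual (M i)) (fun i => ground (M i) :\: B i).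
Proof.
case=> bB cB; split=> [i|i j e nij /= gi gj]; first exact: dual_basis.
by rewrite !inE gi gj (cB i j e) // !andbT.
Qed.

Lemma complementary_rigid B : complementary M B -> rigid M.
Proof.
move=> cB; split.
  by case: (disjoint_bases_munion (proj1 cB) (complementary_disjoint cB)).
have cB' := complementary_dual cB.
by case: (disjoint_bases_munion (proj1 cB') (complementary_disjoint cB')).
Qed.

(** The elements that the contraction in [arrow M] removes. *)
Definition shared_elements : {set E} := union_ground M :\: outer_elements M.

Lemma shared_elementsP e :
  reflect (exists i j, [/\ i != j, e \in ground (M i) & e \in ground (M j)])
          (e \in shared_elements).
Proof.
rewrite !inE; apply: (iffP andP) => [[n1 /bigcupP[i _ ei]]|[i [j [nij ei ej]]]].
  have im : i \in members M e by rewrite inE.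
  move: n1; rewrite (cardsD1 i) im eqSS cards_eq0 => /set0Pn[j].
  by rewrite !inE eq_sym => /andP[nij ej]; exists i, j.
split; last by apply/bigcupP; exists i.
apply/negP=> /cards1P[k /setP mk].
have := mk i; have := mk j; rewrite !inE ei ej => /esym/eqP jk /esym/eqP ik.
by rewrite ik jk eqxx in nij.
Qed.

Lemma outer_elements_member_inj e i j : e \in outer_elements M ->
  e \in ground (M i) -> e \in ground (M j) -> i = j.
Proof.
move=> eZ ei ej; apply/eqP/negPn/negP=> nij.
have : e \in shared_elements by apply/shared_elementsP; exists i, j.
by rewrite inE eZ.
Qed.

Lemma complementary_shared B :
  complementary M B -> shared_elements \subset \bigcup_i B i.
Proof.
case=> _ cB; apply/subsetP=> e /shared_elementsP[i [j [nij ei ej]]].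
have [Bi|Bi] := boolP (e \in B j); first by apply/bigcupP; exists j.
by apply/bigcupP; exists i; rewrite ?(cB i j e nij ei ej).
Qed.

Lemma associative_members i j k e : associative_family M ->
  i != j -> e \in ground (M i) -> e \in ground (M j) -> e \in ground (M k) ->
  (k == i) || (k == j).
Proof.
move=> /(_ e) le2 nij ei ej ek; apply/negPn/negP; rewrite negb_or => /andP[ki kj].
move: le2; rewrite leqNgt => /negP; apply.
have c3 : #|[set k; i; j]| = 3 by rewrite -setUA !cardsU1 cards1 !inE negb_or ki kj nij.
rewrite -c3; apply: subset_leq_card; apply/subsetP=> l.
by rewrite !inE => /orP[/orP[]|] /eqP->.
Qed.

(** In an associative family an element of [ground (M i)] and [ground (M j)]
    lies in no third ground set, so the basis that covers it is [B i] or
    [B j], and not both since the bases are disjoint. *)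
Lemma basis_munion_complementary S : associative_family M ->
  rank (munion M) = \sum_i rank (M i) ->
  basis (munion M) S -> shared_elements \subset S ->
  exists2 B, complementary M B & S = \bigcup_i B i.
Proof.
move=> assM rM bS sXS; have [B [bB dB dS]] := basis_munion_split rM bS.
exists B => //; split=> // i j e nij ei ej.
have : e \in S by apply: (subsetP sXS); apply/shared_elementsP; exists i, j.
rewrite dS => /bigcupP[k _ ek].
have gk := subsetP (basis_ground (bB k)) e ek.
case/orP: (associative_members assM nij ei ej gk) => /eqP dk; subst k.
  by rewrite ek (disjointFr (dB i j nij) ek).
by rewrite ek (disjointFl (dB i j nij) ek).
Qed.

(** The complements of pairwise disjoint bases of the duals are bases covering
    every shared element at least once. *)
Lemma shared_elements_indep :
  rank (munion (fun i => dual (M i))) = \sum_i rank (dual (M i)) ->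
  shared_elements \in indep (munion M).
Proof.
move=> rD; have [S bS] := basis_exists (munion (fun i => dual (M i))).
have [C [bC dC _]] := basis_munion_split rD bS.
apply: (@indep_sub _ _ _ (\bigcup_i (ground (M i) :\: C i))).
  apply/subsetP=> e /shared_elementsP[i [j [nij ei ej]]].
  have [Ci|Ci] := boolP (e \in C i); last by apply/bigcupP; exists i; rewrite ?inE ?Ci.
  by apply/bigcupP; exists j; rewrite // inE ej (disjointFr (dC i j nij) Ci).
apply/union_indepP; exists [ffun i => ground (M i) :\: C i] => [i|].
  by rewrite ffunE; have := bC i; rewrite basis_dualE => /andP[_ /basis_indep].
by apply: eq_bigr => i _; rewrite ffunE.
Qed.

Lemma rigid_complementary :
  associative_family M -> rigid M -> exists B, complementary M B.
Proof.
move=> assM [rM /shared_elements_indep/indep_sub_basis[S bS sXS]].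
by have [B cB _] := basis_munion_complementary assM rM bS sXS; exists B.
Qed.

(** * Bases of the arrow matroid *)

Lemma basis_arrowE J : shared_elements \in indep (munion M) ->
  basis (arrow M) J =
    (J \subset outer_elements M) && basis (munion M) (J :|: shared_elements).
Proof.
move=> IX; apply: basis_contractionE => //.
apply/subsetP=> e; rewrite -ground_arrow => eZ.
by move: eZ; rewrite /arrow /= inE => /andP[].
Qed.

Lemma complementary_basis_arrow B : complementary M B ->
  basis (arrow M) ((\bigcup_i B i) :&: outer_elements M).
Proof.
move=> cB; have [_ rD] := complementary_rigid cB.
rewrite basis_arrowE ?shared_elements_indep // subsetIr /=.
suff -> : (\bigcup_i B i) :&: outer_elements M :|: shared_elements = \bigcup_i B i.
  by case: (disjoint_bases_munion (proj1 cB) (complementary_disjoint cB)).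
have sX := complementary_shared cB.
apply/eqP; rewrite eqEsubset subUset subsetIl sX /=.
apply/subsetP=> e eB; rewrite !inE eB /=; case: (_ == 1) => //=.
case/bigcupP: eB => i _ ei; apply/bigcupP; exists i => //.
exact: subsetP (basis_ground (proj1 cB i)) e ei.
Qed.

Lemma basis_arrow_complementary J : associative_family M -> rigid M ->
  basis (arrow M) J ->
  exists2 B, complementary M B & J = (\bigcup_i B i) :&: outer_elements M.
Proof.
move=> assM [rM /shared_elements_indep IX].
rewrite basis_arrowE // => /andP[sJ bJ].
have [B cB dJ] := basis_munion_complementary assM rM bJ (subsetUr _ _).
exists B => //; rewrite -dJ setIUl (setIidPl sJ) /shared_elements.
by rewrite setIC setIDA setIC setDIl setDv setI0 setU0.
Qed.

Lemma complementary_trace B e i : complementary M B ->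
  e \in outer_elements M -> e \in ground (M i) ->
  (e \in (\bigcup_k B k) :&: outer_elements M) = (e \in B i).
Proof.
move=> [bB _] eZ ei; rewrite in_setI eZ andbT.
apply/bigcupP/idP=> [[k _ ek]|]; last by exists i.
have gk := subsetP (basis_ground (bB k)) e ek.
by rewrite (outer_elements_member_inj eZ ei gk).
Qed.

End Complementary.

(** * Splitting along a partition *)

Section Partition.
Variables (E I : finType) (M : I -> matroid E) (P : {set {set I}}).
Hypotheses (assM : associative_family M) (partP : partition P [set: I]).

Lemma outer_subfamilyE (A : {set I}) e :
  (e \in outer_elements (subfamily M A)) = (#|members M e :&: A| == 1).
Proof.
rewrite inE -(card_imset _ val_inj).
suff -> : val @: members (subfamily M A) e = members M e :&: A by [].
apply/setP=> i; apply/imsetP/idP => [[k]|]; rewrite !inE.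
  by move=> ek ->; rewrite ek (valP k).
by case/andP=> ei iA; exists (Sub i iA); rewrite ?inE.
Qed.

Lemma outer_subfamily_member (A : {set I}) e :
  e \in outer_elements (subfamily M A) -> exists2 i, i \in A & e \in ground (M i).
Proof.
rewrite outer_subfamilyE => /cards1P[i /setP/(_ i)].
by rewrite !inE eqxx => /andP[ei iA]; exists i.
Qed.

(** As at most two ground sets contain [e], sharing it with a ground set outside
    [A] makes it outer in [A]. *)
Lemma outer_subfamily (A : {set I}) i j e : i \in A -> j \notin A ->
  e \in ground (M i) -> e \in ground (M j) ->
  e \in outer_elements (subfamily M A).
Proof.
move=> iA jA ei ej; rewrite outer_subfamilyE; apply/cards1P; exists i.
have nij : i != j by apply: contraNneq jA => <-.
apply/setP=> k; rewrite !inE; apply/andP/eqP=> [[ek kA]|->] //.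
case/orP: (associative_members assM nij ei ej ek) => /eqP // dk.
by rewrite dk (negPf jA) in kA.
Qed.

Lemma complementary_subfamily B (A : {set I}) : complementary M B ->
  complementary (subfamily M A) (fun i => B (val i)).
Proof.
by case=> bB cB; split=> [i|i j e nij]; [apply: bB | apply: cB].
Qed.

Lemma block_unique (A A' : {set I}) i :
  A \in P -> A' \in P -> i \in A -> i \in A' -> A = A'.
Proof.
have /and3P[_ tiP _] := partP.
by move=> PA PA' iA iA'; rewrite -(def_pblock tiP PA iA) (def_pblock tiP PA' iA').
Qed.

Lemma rigid_split : rigid M ->
  (forall A : {set I}, A \in P -> rigid (subfamily M A)) /\
  rigid (arrow_family M P).
Proof.
case/(rigid_complementary assM)=> B cB; split=> [A _|].
  exact: complementary_rigid (complementary_subfamily A cB).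
pose J (A : {A | A \in P}) :=
  (\bigcup_(i : {i | i \in val A}) B (val i)) :&: outer_elements (subfamily M (val A)).
apply: (@complementary_rigid _ _ _ J); split=> [A|A A' e nA].
  exact: complementary_basis_arrow (complementary_subfamily _ cB).
rewrite !ground_arrow => eA eA'.
have [i iA ei] := outer_subfamily_member eA.
have [j jA ej] := outer_subfamily_member eA'.
rewrite (@complementary_trace _ _ _ _ _ (Sub i iA) (complementary_subfamily _ cB) eA ei).
rewrite (@complementary_trace _ _ _ _ _ (Sub j jA) (complementary_subfamily _ cB) eA' ej).
apply: (proj2 cB) => //=; apply: contraNneq nA => dij.
by apply/eqP/val_inj; apply: (block_unique (valP A) (valP A') iA); rewrite dij.
Qed.

Lemma rigid_glue :
  (forall A : {set I}, A \in P -> rigid (subfamily M A)) ->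
  rigid (arrow_family M P) -> rigid M.
Proof.
move=> rigP /(rigid_complementary (arrow_family_associative partP assM))[J [bJ cJ]].
(* The bases are indexed by the whole of [I], with a default value outside the
   block, so that bases for different blocks have the same type. *)
have /fin_all_exists[B hB] (A : {A | A \in P}) : exists B : I -> {set E},
    complementary (subfamily M (val A)) (fun i => B (val i)) /\
    J A = (\bigcup_(i : {i | i \in val A}) B (val i))
            :&: outer_elements (subfamily M (val A)).
  have [B cB dJ] := basis_arrow_complementary (subfamily_associative _ assM)
                      (rigP _ (valP A)) (bJ A).
  exists (fun i => oapp B set0 (insub i)).
  split; first by split=> [i|i j e]; rewrite !valK; [apply: cB.1 | apply: cB.2].
  by rewrite dJ; congr (_ :&: _); apply: eq_bigr => i _; rewrite valK.
have covP i : i \in cover P by case/and3P: partP => /eqP->; rewrite inE.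
pose blk i : {A | A \in P} := Sub (pblock P i) (pblock_mem (covP i)).
have iblk i : i \in val (blk i) by rewrite /= mem_pblock.
apply: (@complementary_rigid _ _ _ (fun i => B (blk i) i)); split=> [i|i j e nij ei ej].
  exact: (hB (blk i)).1.1 (Sub i (iblk i)).
have [eb|nb] := eqVneq (blk i) (blk j).
  have jA : j \in val (blk i) by rewrite eb iblk.
  by rewrite -eb; apply: ((hB (blk i)).1.2 (Sub i (iblk i)) (Sub j jA)).
have out k l : blk k != blk l -> l \notin val (blk k).
  apply: contraNN => lk; apply/eqP/val_inj.
  exact: block_unique (valP _) (valP _) lk (iblk l).
have nb' : blk j != blk i by rewrite eq_sym.
have eZi := outer_subfamily (iblk i) (out i j nb) ei ej.
have eZj := outer_subfamily (iblk j) (out j i nb') ej ei.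
have trace k : e \in outer_elements (subfamily M (val (blk k))) ->
    e \in ground (M k) -> (e \in J (blk k)) = (e \in B (blk k) k).
  have [cBk ->] := hB (blk k) => eZk ek.
  exact: (@complementary_trace _ _ _ _ _ (Sub k (iblk k)) cBk eZk ek).
rewrite -(trace i eZi ei) -(trace j eZj ej).
by apply: cJ nb _ _; rewrite ground_arrow.
Qed.

End Partition.

Theorem theorem67 (E I : finType) (M : I -> matroid E) (P : {set {set I}})
  (assocM : associative_family M)
  (connM : graph_connected M)
  (edgesM : graph_edges M != set0)
  (partP : partition P [set: I]) :
  rigid M <->
  (forall A : {set I}, A \in P -> rigid (subfamily M A)) /\
  rigid (arrow_family M P).
Proof.
split; first exact: rigid_split.
by case; apply: rigid_glue.
Qed.
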